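(* Let $f:[0,1]\to\mathbb{R}$ be continuously differentiable on $[0,1]$. Then for any integer $n>1$ and any $x\in[0,1]$, $$\left| R_n(f;x)-f(x)\right| \le \frac{\omega_1\left(n^{-1/2}\right)}{n^{1/2}}\left(x(1-x)\big(1-\min\{x,1-x\}\big)+\sqrt{x(1-x)\big(1-\min\{x,1-x\}\big)}\right),$$ where $\omega_1(\delta)$ denotes the modulus of continuity of $f'$. In particular, $$\left| R_n(f;x)-f(x)\right| \le \frac{4+6\sqrt{3}}{27}\,n^{-1/2}\,\omega_1\left(n^{-1/2}\right),\qquad x\in[0,1].$$
   Context: For $x,h\in\mathbb{R}$ and an integer $n\ge 0$, the generalized rising factorial with increment $h$ is $x^{(n,h)}=x(x+h)(x+2h)\cdots(x+(n-1)h)$, with the convention $x^{(0,h)}=1$. For an integer $n>1$, a function $f:[0,1]\to\mathbb{R}$ and $x\in[0,1]$, put $c=c(n,x)=-\frac{\min\{x,1-x\}}{n-1}$ and define $$R_n(f;x)=\sum_{k=0}^{n}\binom{n}{k}\frac{x^{(k,c)}\,(1-x)^{(n-k,c)}}{1^{(n,c)}}\,f\left(\frac{k}{n}\right).$$ For $f$ continuously differentiable on $[0,1]$, $\omega_1(\delta)=\max\{|f'(x)-f'(y)| : x,y\in[0,1],\ |x-y|\le\delta\}$ for $\delta>0$. *)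

(* Defs.v *)
From mathcomp Require Import all_boot all_order all_algebra.
From mathcomp Require Import all_classical all_reals all_analysis.

Set Implicit Arguments.
Unset Strict Implicit.
Unset Printing Implicit Defensive.

Import Order.TTheory GRing.Theory Num.Theory.
Import numFieldNormedType.Exports.

Local Open Scope classical_set_scope.
Local Open Scope ring_scope.

Section Defs.
Variable R : realType.
Implicit Types (f : R -> R) (x h delta : R) (n : nat).

(* A function on [0, 1] is represented by a total f : R -> R; the definitions
   below only use its values at points of [0, 1]. *)

Definition rising_fact x h n : R := \prod_(i < n) (x + i%:R * h).

Definition polya_incr n x : R := - (Num.min x (1 - x) / (n%:R - 1)).

Definition polya_op n f x : R :=
  \sum_(k < n.+1) 'C(n, k)%:R *
    (rising_fact x (polya_incr n x) k *
     rising_fact (1 - x) (polya_incr n x) (n - k) /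
     rising_fact 1 (polya_incr n x) n) * f (k%:R / n%:R).

(* The difference quotient only sees points y of [0, 1] with y != x, so the
   derivative is two-sided in ]0, 1[ and one-sided at 0 and 1. *)
Definition punctured01 x : set_system R := within `[0, 1] x^'.

Definition diff_quot f x (y : R) : R := (f y - f x) / (y - x).

Definition deriv01 f x : R := lim (diff_quot f x @ punctured01 x).

Definition C1_01 f : Prop :=
  (forall x, 0 <= x <= 1 -> cvg (diff_quot f x @ punctured01 x)) /\
  {within `[0, 1], continuous (deriv01 f)}.

(* For f of class C^1 and 0 <= delta, the set is nonempty and compact, hence
   this supremum is a maximum. *)
Definition omega1 f delta : R :=
  sup [set t | exists x y : R, [/\ 0 <= x <= 1, 0 <= y <= 1,
    `|x - y| <= delta & t = `|deriv01 f x - deriv01 f y|]].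

End Defs.

(* Main.v *)
Require Import Defs.
From mathcomp Require Import all_boot all_order all_algebra.
From mathcomp Require Import all_classical all_reals all_analysis.
From mathcomp Require Import ring lra.

Import Order.TTheory GRing.Theory Num.Theory.
Import numFieldNormedType.Exports.

(** The operator [polya_op n] is an average against the Polya weights, which are
    nonnegative since [c >= - min x (1 - x) / (n - 1)].  Their moments come from
    the Vandermonde identity for rising factorials: total mass [1], mean [x] and
    variance [x (1 - x) (1 + n c) / (n (1 + c)) <= x (1 - x) (1 - m) / n] with
    [m = min x (1 - x)].  The mean value theorem and the subdivision inequality
    for [omega1] give
      [|f t - f x - f' x (t - x)| <= (|t - x| + (t - x)^2 / d) omega1 d],
    where the linear term on the left averages to zero; the claim follows by
    Cauchy-Schwarz with [d = n^(-1/2)].  Finally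
    [x (1 - x) (1 - m) = m (1 - m)^2] is at most [4/27], attained at [m = 1/3]. *)

Local Open Scope ring_scope.

(** * Vandermonde identity and moments of the Polya weights *)

Section PolyaWeights.
Variable R : realType.
Implicit Types (x y h : R) (n k : nat) (F : nat -> R).

Lemma rising_factS x h n :
  rising_fact x h n.+1 = x * rising_fact (x + h) h n.
Proof.
rewrite /rising_fact big_ord_recl mul0r addr0; congr (_ * _).
by apply: eq_bigr => i _; rewrite /= /bump /= -natr1; ring.
Qed.

(** The normalisation is left out and [y] is independent of [x], so that [x] can be shifted by [h]
    with [y] fixed. *)
Definition polya_weight n h x y k : R :=
  'C(n, k)%:R * (rising_fact x h k * rising_fact y h (n - k)).

Lemma polya_weight_sym n h x y k : (k <= n)%N ->
  polya_weight n h x y (n - k) = polya_weight n h y x k.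
Proof.
by move=> kn; rewrite /polya_weight bin_sub // subKn // [X in _ * X]mulrC.
Qed.

(** Absorption, [k C(n+1,k) = (n+1) C(n,k-1)], while the first factor [x] leaves the rising
    factorial. Arbitrary [F] allows iteration to higher factorial moments. *)
Lemma sum_polya_weight_shift F n h x y :
  \sum_(k < n.+2) k%:R * F k * polya_weight n.+1 h x y k =
  n.+1%:R * x * \sum_(k < n.+1) F k.+1 * polya_weight n h (x + h) y k.
Proof.
rewrite big_ord_recl !mul0r add0r mulr_sumr; apply: eq_bigr => k _.
rewrite /= /bump /= add1n /polya_weight subSS rising_factS.
have := congr1 (fun m => m%:R : R) (mul_bin_diag n.+1 k).
rewrite /= !natrM => e.
transitivity (k.+1%:R * 'C(n.+1, k.+1)%:R *
  (F k.+1 * (x * rising_fact (x + h) h k * rising_fact y h (n - k)))).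
  by ring.
by rewrite -e; ring.
Qed.

(* Multiplying by n.+1 = k + (n.+1 - k) reduces degree n.+1 to two sums of
   degree n, at (x + h, y) and at (x, y + h). *)
Lemma sum_polya_weight n h x y :
  \sum_(k < n.+1) polya_weight n h x y k = rising_fact (x + y) h n.
Proof.
elim: n x y => [|n IHn] x y.
  by rewrite big_ord1 /polya_weight /rising_fact !big_ord0 bin0 !mulr1.
have shift1 u v : \sum_(k < n.+2) k%:R * polya_weight n.+1 h u v k =
    n.+1%:R * u * rising_fact (u + v + h) h n.
  have := sum_polya_weight_shift (fun=> 1) n h u v.
  under eq_bigr do rewrite mulr1.
  by move=> ->; under eq_bigr do rewrite mul1r; rewrite IHn addrAC.
apply: (@mulfI _ n.+1%:R); first by rewrite pnatr_eq0.
rewrite mulr_sumr.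
transitivity (\sum_(k < n.+2) k%:R * polya_weight n.+1 h x y k +
    \sum_(k < n.+2) k%:R * polya_weight n.+1 h y x k).
  rewrite [X in _ + X](reindex_inj rev_ord_inj) -big_split /=.
  apply: eq_bigr => k _; have kn : (k <= n.+1)%N by rewrite -ltnS.
  by rewrite subSS polya_weight_sym // -mulrDl -natrD subnKC.
by rewrite !shift1 rising_factS (addrC y x); ring.
Qed.

Lemma sum_polya_weight_mean n h x y :
  \sum_(k < n.+2) k%:R * polya_weight n.+1 h x y k =
  n.+1%:R * x * rising_fact (x + y + h) h n.
Proof.
have := sum_polya_weight_shift (fun=> 1) n h x y.
under eq_bigr do rewrite mulr1.
by move=> ->; under eq_bigr do rewrite mul1r; rewrite sum_polya_weight addrAC.
Qed.

(** After the index shift [k - 1] becomes [k], so the second factorial moment reduces to the mean at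
    [x + h]. *)
Lemma sum_polya_weight_falling2 n h x y :
  \sum_(k < n.+3) k%:R * (k%:R - 1) * polya_weight n.+2 h x y k =
  n.+2%:R * n.+1%:R * x * (x + h) * rising_fact (x + y + h + h) h n.
Proof.
rewrite (sum_polya_weight_shift (fun k => k%:R - 1)).
under eq_bigr do rewrite -natr1 addrK.
by rewrite sum_polya_weight_mean (addrAC x h y); ring.
Qed.

Lemma sum_polya_weight_var n h x : 1 + h != 0 ->
  \sum_(k < n.+3) (k%:R / n.+2%:R - x) ^+ 2 * polya_weight n.+2 h x (1 - x) k =
  x * (1 - x) * (1 + n.+2%:R * h) / (n.+2%:R * (1 + h)) * rising_fact 1 h n.+2.
Proof.
move=> h1; have n0 : n.+2%:R != 0 :> R by rewrite pnatr_eq0.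
pose w := polya_weight n.+2 h x (1 - x).
(* The square is expanded in the factorial basis [k (k - 1)], [k], [1]. *)
transitivity (n.+2%:R ^- 2 * \sum_(k < n.+3) k%:R * (k%:R - 1) * w k +
    (n.+2%:R ^- 2 - 2 * x / n.+2%:R) * \sum_(k < n.+3) k%:R * w k +
    x ^+ 2 * \sum_(k < n.+3) w k).
  rewrite !mulr_sumr -!big_split /=; apply: eq_bigr => k _; rewrite -/(w k).
  by field.
rewrite sum_polya_weight_falling2 sum_polya_weight_mean sum_polya_weight.
rewrite subrKC !rising_factS.
have -> : n.+1%:R = n.+2%:R - 1 :> R by rewrite -(natr1 n.+1) addrK.
by field; rewrite h1 -(natrD _ 2 n) pnatr_eq0.
Qed.

End PolyaWeights.

Arguments polya_weight {R} n h x y k.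

(** * Mean value theorem and first-order Taylor estimate on [0, 1] *)

Section C1Unit.
Local Open Scope classical_set_scope.
Variables (R : realType) (f : R -> R).
Hypothesis hf : C1_01 f.
Local Notation g := (deriv01 f).

Lemma C1_01_is_derive (x : R) : 0 < x < 1 -> is_derive x 1 f (g x).
Proof.
move=> x01.
have fx : diff_quot f x y @[y --> punctured01 x] --> g x.
  by apply: hf.1; case/andP: x01 => *; rewrite !ltW.
have dq (h : R) :
    h^-1 *: ((f \o shift x) (h *: (1 : R)) - f x) = diff_quot f x (x + h).
  by rewrite /diff_quot /= (addrC x) addrK [h *: 1]mulr1 mulrC.
have fx' : h^-1 *: ((f \o shift x) (h *: (1 : R)) - f x) @[h --> 0^'] --> g x.
  apply/cvgrPdist_le => e e0; move/cvgrPdist_le : fx => /(_ e e0).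
  rewrite /punctured01 /dnbhs !near_withinE => /nbhs0P fx.
  (* As [x] is interior, [x + h] stays in ]0, 1[ for small [h], and the restriction to [0, 1] is
     harmless. *)
  have /near_in_itvoo /nbhs0P : x \in `]0, 1[%R by rewrite in_itv.
  apply: filterS2 fx => h /= fx; rewrite in_itv /= => /andP[hx0 hx1] h0.
  rewrite -[X in _ - X]/(h^-1 *: ((f \o shift x) (h *: (1 : R)) - f x)) dq fx //.
  - by rewrite addrC -subr_eq0 addrK.
  - by rewrite in_itv /= !ltW.
by split; [apply/cvg_ex; exists (g x) | exact/cvg_lim].
Qed.

(** Near [x], endpoints included, the difference quotient is bounded by [M = |g x| + 1], whence
    [|f x - f y| <= M |y - x|]. *)
Lemma C1_01_continuous : {within `[0, 1], continuous f}.
Proof.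
apply/subspace_continuousP => x /=; rewrite in_itv /= => x01.
have /cvgrPdist_le /(_ 1 ltr01) fx :
  diff_quot f x y @[y --> punctured01 x] --> g x by exact: hf.1.
apply/cvgrPdist_le => e e0; move: fx.
rewrite /punctured01 /dnbhs !near_withinE => fx.
pose M := `|g x| + 1; have M0 : 0 < M by rewrite ltr_wpDl.
have xM : \forall y \near x, `|y - x| <= e / M.
  by apply: (cvgr_distC_le id x cvg_id); exact: divr_gt0.
apply: filterS2 fx xM => y fx yxM y01 /=.
have [->|yx] := eqVneq y x; first by rewrite subrr normr0 ltW.
have fy : `|diff_quot f x y| <= M.
  rewrite /M addrC -lerBlDr (le_trans _ (fx yx y01)) // distrC.
  exact: lerB_dist.
have -> : f x - f y = - (diff_quot f x y * (y - x)).
  by rewrite /diff_quot divfK ?opprB // subr_eq0.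
rewrite normrN normrM (le_trans (ler_pM _ _ fy yxM)) //.
by rewrite mulrC divfK // gt_eqF.
Qed.

Lemma C1_01_mvt (x y : R) : 0 <= x <= 1 -> 0 <= y <= 1 ->
  exists c, [/\ 0 <= c <= 1, `|c - x| <= `|y - x| & f y - f x = g c * (y - x)].
Proof.
have mvt (a b : R) : 0 <= a -> a <= b -> b <= 1 ->
    exists2 c, c \in `[a, b]%R & f b - f a = g c * (b - a).
  move=> a0 ab b1; apply: MVT_segment => //.
    move=> z; rewrite in_itv /= => /andP[az zb]; apply: C1_01_is_derive.
    by rewrite (le_lt_trans a0 az) (lt_le_trans zb b1).
  apply: continuous_subspaceW C1_01_continuous.
  by move=> z; rewrite /= !in_itv /= => /andP[az zb]; apply/andP; split; lra.
move=> /andP[x0 x1] /andP[y0 y1]; have [xy|/ltW yx] := leP x y.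
- have [c] := mvt _ _ x0 xy y1; rewrite in_itv /= => /andP[xc cy] e.
  exists c; split => //; first by apply/andP; split; lra.
  by rewrite !ger0_norm ?subr_ge0 // lerD2r.
- have [c] := mvt _ _ y0 yx x1; rewrite in_itv /= => /andP[xc cy] e.
  exists c; split => //; first by apply/andP; split; lra.
  + by rewrite !ler0_norm ?subr_le0 // lerN2 lerD2r.
  + by rewrite -opprB e -mulrN opprB.
Qed.

(** The supremum is a genuine upper bound because [g] is bounded, as a continuous function on a
    compact segment. *)
Lemma omega1_ge (x y d : R) : 0 <= x <= 1 -> 0 <= y <= 1 -> `|x - y| <= d ->
  `|g x - g y| <= omega1 f d.
Proof.
move=> x01 y01 xyd; apply: ub_le_sup; last by exists x, y.
have [M [_ /(_ (M + 1))]] :=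
  compact_bounded (continuous_compact hf.2 (@segment_compact R 0 1)).
rewrite ltrDl => /(_ ltr01) gM.
exists (M + 1 + (M + 1)) => _ [u [v [u01 v01 _ ->]]].
by rewrite (le_trans (ler_normB _ _)) // lerD // gM //=;
  [exists u | exists v].
Qed.

Lemma omega1_ge0 (d : R) : 0 <= d -> 0 <= omega1 f d.
Proof.
move=> d0; rewrite -(normr0 R) -(subrr (g 0)).
by rewrite omega1_ge ?lexx ?ler01 ?subrr ?normr0.
Qed.

(* A path from x to y splits into at most 1 + |x - y| / d steps of length d. *)
Lemma deriv01_dist_le (x y d : R) : 0 <= x <= 1 -> 0 <= y <= 1 -> 0 < d ->
  `|g x - g y| <= (1 + `|x - y| / d) * omega1 f d.
Proof.
move=> x01 y01 d0.
have chain (m : nat) (u v : R) : 0 <= u <= 1 -> 0 <= v <= 1 ->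
    `|u - v| <= m.+1%:R * d -> `|g u - g v| <= m.+1%:R * omega1 f d.
  elim: m u v => [|m IHm] u v u01 v01 uv.
    by rewrite mul1r omega1_ge // -[d]mul1r.
  (* [w] is the first of the points cutting the path from [u] to [v] into [m + 2] equal steps; the
     induction hypothesis covers the rest. *)
  pose t : R := m.+2%:R^-1; pose w := u + t * (v - u).
  have t0 : 0 < t by rewrite invr_gt0.
  have t1 : t <= 1 by rewrite invf_le1 ?ler1n.
  have tm : t * m.+2%:R = 1 by rewrite mulVf // pnatr_eq0.
  have w01 : 0 <= w <= 1.
    rewrite /w; move: u01 v01 => /andP[u0 u1] /andP[v0 v1].
    by apply/andP; split; nra.
  have uw : `|u - w| <= d.
    have -> : u - w = t * (u - v) by rewrite /w; ring.
    by rewrite normrM gtr0_norm // mulrC ler_pdivrMr // mulrC.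
  have wv : `|w - v| <= m.+1%:R * d.
    have -> : w - v = m.+1%:R * (t * (u - v)).
      transitivity ((t * m.+2%:R - t) * (u - v)); first by rewrite tm /w; ring.
      by rewrite -(natr1 m.+1); ring.
    rewrite normrM normr_nat ler_pM2l ?ltr0Sn // normrM gtr0_norm //.
    by rewrite mulrC ler_pdivrMr // mulrC.
  rewrite -(subrKA (g w)) (le_trans (ler_normD _ _)) //.
  by rewrite -(natr1 m.+1) mulrDl mul1r addrC lerD ?IHm ?omega1_ge.
have q0 : 0 <= `|x - y| / d by rewrite divr_ge0 // ltW.
(* With [m] the integer part of [q = |x - y| / d], one has [q < m + 1 <= 1 + q]. *)
have /andP[tq qt] := truncn_itv q0.
apply: (le_trans (chain _ _ _ x01 y01 _)); last first.
  by rewrite ler_wpM2r ?omega1_ge0 ?(ltW d0) // -natr1 addrC lerD2l; exact: tq.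
by rewrite -ler_pdivrMr // ltW.
Qed.

Lemma C1_01_taylor1 (x y d : R) : 0 <= x <= 1 -> 0 <= y <= 1 -> 0 < d ->
  `|f y - f x - g x * (y - x)| <=
  (`|y - x| + (y - x) ^+ 2 / d) * omega1 f d.
Proof.
move=> x01 y01 d0; have [c [c01 cxy ->]] := C1_01_mvt _ _ x01 y01.
rewrite -mulrBl normrM -(real_normK (num_real (y - x))).
have -> : (`|y - x| + `|y - x| ^+ 2 / d) * omega1 f d =
    (1 + `|y - x| / d) * omega1 f d * `|y - x| by ring.
rewrite ler_wpM2r //.
apply: (le_trans (deriv01_dist_le _ _ _ c01 x01 d0)).
rewrite ler_wpM2r ?lerD2l ?ler_pM2r ?invr_gt0 //.
by rewrite omega1_ge0 // ltW.
Qed.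

End C1Unit.

(** Stated for any finite probability [p] with mean [x]; only a bound [V] on the variance enters. *)
Lemma C1_01_mean_dist_le (R : realType) (f : R -> R) (N : nat)
    (p t : 'I_N -> R) (x d V : R) : C1_01 f -> 0 <= x <= 1 ->
  (forall k, 0 <= t k <= 1) -> 0 < d ->
  (forall k, 0 <= p k) -> \sum_k p k = 1 -> \sum_k p k * t k = x ->
  \sum_k p k * (t k - x) ^+ 2 <= V ->
  `|\sum_k p k * f (t k) - f x| <= (Num.sqrt V + V / d) * omega1 f d.
Proof.
move=> hf x01 t01 d0 p0 p1 pt pV.
have -> : \sum_k p k * f (t k) - f x =
    \sum_k p k * (f (t k) - f x - deriv01 f x * (t k - x)).
  transitivity (\sum_k p k * f (t k) + (- f x + deriv01 f x * x) * \sum_k p k -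
      deriv01 f x * \sum_k p k * t k); first by rewrite p1 pt; ring.
  rewrite !mulr_sumr -big_split -sumrB /=.
  by apply: eq_bigr => k _; ring.
pose u := \sum_k p k * `|t k - x|.
have u0 : 0 <= u by apply: sumr_ge0 => k _; rewrite mulr_ge0.
have uV : u <= Num.sqrt V.
  (* Cauchy-Schwarz, as nonnegativity of the variance of [|t k - x|], whose mean is [u]. *)
  have : 0 <= \sum_k p k * (`|t k - x| - u) ^+ 2.
    by apply: sumr_ge0 => k _; rewrite mulr_ge0 ?sqr_ge0.
  have -> : \sum_k p k * (`|t k - x| - u) ^+ 2 =
      \sum_k p k * (t k - x) ^+ 2 - u ^+ 2.
    transitivity (\sum_k p k * (t k - x) ^+ 2 -
        2 * u * (\sum_k p k * `|t k - x|) + u ^+ 2 * \sum_k p k).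
      move: (u) => v; rewrite !mulr_sumr -sumrB -big_split /=.
      by apply: eq_bigr => k _; rewrite -(real_normK (num_real (t k - x))); ring.
    by rewrite p1 -/u; ring.
  rewrite subr_ge0 => uV; rewrite -(ger0_norm u0) -sqrtr_sqr ler_wsqrtr //.
  exact: le_trans pV.
apply: (le_trans (ler_norm_sum _ _ _)).
apply: (@le_trans _ _ ((u + V / d) * omega1 f d)); last first.
  by rewrite ler_wpM2r ?lerD2r // omega1_ge0 // ltW.
apply: (@le_trans _ _ ((u + (\sum_k p k * (t k - x) ^+ 2) / d) * omega1 f d));
  last by rewrite ler_wpM2r ?lerD2l ?ler_pM2r ?invr_gt0 // omega1_ge0 // ltW.
rewrite /u !mulr_suml -big_split mulr_suml /=; apply: ler_sum => k _.
rewrite normrM (ger0_norm (p0 k)).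
have -> : (p k * `|t k - x| + p k * (t k - x) ^+ 2 / d) * omega1 f d =
    p k * ((`|t k - x| + (t k - x) ^+ 2 / d) * omega1 f d) by ring.
rewrite ler_wpM2l //; exact: C1_01_taylor1.
Qed.

(** * Positivity and variance for the increment [c = - m / (n + 1)] in degree [n + 2] *)

Section PolyaOperator.
Variables (R : realType) (n : nat) (x : R).
Hypothesis hx : 0 <= x <= 1.
Local Notation m := (Num.min x (1 - x)).
Local Notation c := (polya_incr n.+2 x).

Lemma min_onem_bounds : [/\ 0 <= m, m <= x & m <= 1 - x].
Proof.
have /andP[x0 x1] := hx; split.
- by rewrite le_min x0 subr_ge0.
- by rewrite ge_min lexx.
- by rewrite ge_min lexx orbT.
Qed.

Lemma polya_incrE : c = - (m / n.+1%:R).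
Proof. by rewrite /polya_incr -(natr1 n.+1) addrK. Qed.

(** Each factor has index [i <= n + 1], so [y + i c >= y - m >= 0]. *)
Lemma rising_fact_ge0 (y : R) k : m <= y -> (k <= n.+2)%N ->
  0 <= rising_fact y c k.
Proof.
move=> my kn; apply: prodr_ge0 => i _.
have [m0 _ _] := min_onem_bounds.
rewrite polya_incrE mulrN subr_ge0 (le_trans _ my) // mulrCA.
rewrite -[leRHS]mulr1 ler_wpM2l // ler_pdivrMr ?ltr0Sn // mul1r ler_nat.
by rewrite -ltnS (leq_trans (ltn_ord i)).
Qed.

(** Strict because every factor is at least [1 - m], and [m <= 1/2]. *)
Lemma rising_fact1_gt0 k : (k <= n.+2)%N -> 0 < rising_fact 1 c k.
Proof.
move=> kn; apply: prodr_gt0 => i _.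
have [m0 mx mx'] := min_onem_bounds.
have : m * (i%:R / n.+1%:R) <= m.
  rewrite -[leRHS]mulr1 ler_wpM2l // ler_pdivrMr ?ltr0Sn // mul1r ler_nat.
  by rewrite -ltnS (leq_trans (ltn_ord i)).
by rewrite polya_incrE mulrN (mulrCA i%:R) subr_gt0 => /le_lt_trans; apply; lra.
Qed.

Lemma polya_variance_le :
  x * (1 - x) * (1 + n.+2%:R * c) / (n.+2%:R * (1 + c)) <=
  x * (1 - x) * (1 - m) / n.+2%:R.
Proof.
have [m0 mx mx'] := min_onem_bounds; have /andP[x0 x1] := hx.
have n0 : 0 < n.+1%:R :> R by [].
have N0 : 0 < n.+2%:R :> R by [].
have c1 : 0 < 1 + c.
  have : m / n.+1%:R <= m.
    by rewrite ler_pdivrMr // -[leLHS]mulr1 ler_wpM2l // ler1n.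
  by rewrite polya_incrE subr_gt0 => /le_lt_trans; apply; lra.
rewrite invfM mulrA [X in X <= _](mulrAC _ n.+2%:R^-1) ler_pM2r ?invr_gt0 //.
rewrite ler_pdivrMr // -!mulrA ler_wpM2l // ler_wpM2l ?subr_ge0 //.
(* Eliminating [m] makes the difference of the two sides a manifest [c^2 (n + 1)]. *)
have mE : m = - c * n.+1%:R by rewrite polya_incrE opprK divfK ?gt_eqF.
rewrite -(natr1 n.+1) mE -subr_ge0; set s := n.+1%:R.
suff -> : (1 - - c * s) * (1 + c) - (1 + (s + 1) * c) = c ^+ 2 * s.
  by rewrite mulr_ge0 ?sqr_ge0 // ltW.
by ring.
Qed.

End PolyaOperator.

Lemma polya_op_dist_le (R : realType) (f : R -> R) (n : nat) (x d : R) :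
  C1_01 f -> (1 < n)%N -> 0 <= x <= 1 -> 0 < d ->
  `|polya_op n f x - f x| <=
  (Num.sqrt (x * (1 - x) * (1 - Num.min x (1 - x)) / n%:R) +
   x * (1 - x) * (1 - Num.min x (1 - x)) / n%:R / d) * omega1 f d.
Proof.
case: n => [|[|n]] // hf _ hx d0; set B := x * _ * _ / _.
have [m0 mx mx'] := min_onem_bounds _ _ hx; have /andP[x0 x1] := hx.
pose c := polya_incr n.+2 x; pose r := rising_fact 1 c n.+2.
have r0 : 0 < r by exact: rising_fact1_gt0.
have c1 : 0 < 1 + c.
  (* The rising factorial of 1 of length 2 is [1 + c]. *)
  have := rising_fact1_gt0 _ n _ hx 2%N isT.
  by rewrite !rising_factS /rising_fact big_ord0 mulr1 mul1r.
pose p (k : 'I_n.+3) := polya_weight n.+2 c x (1 - x) k / r.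
pose t (k : 'I_n.+3) : R := k%:R / n.+2%:R.
have opE : polya_op n.+2 f x = \sum_k p k * f (t k).
  by apply: eq_bigr => k _; rewrite /p /polya_weight /= !mulrA.
have t01 k : 0 <= t k <= 1.
  apply/andP; split; first by rewrite divr_ge0.
  by rewrite ler_pdivrMr // mul1r ler_nat -ltnS.
have p0 k : 0 <= p k.
  have kn : (k <= n.+2)%N by rewrite -ltnS.
  rewrite divr_ge0 ?(ltW r0) // mulr_ge0 // mulr_ge0 //.
  - exact: rising_fact_ge0.
  - by apply: rising_fact_ge0 => //; exact: leq_subr.
have p1 : \sum_k p k = 1.
  by rewrite -mulr_suml sum_polya_weight subrKC divff ?gt_eqF.
have pt : \sum_k p k * t k = x.
  transitivity ((\sum_(k < n.+3) k%:R * polya_weight n.+2 c x (1 - x) k) /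
      (n.+2%:R * r)).
    rewrite mulr_suml; apply: eq_bigr => k _.
    by rewrite /p /t invfM; ring.
  rewrite sum_polya_weight_mean subrKC.
  (* The leading factor of [r] is 1, so the mean carries the same normalisation as the total
     mass. *)
  have <- : r = rising_fact (1 + c) c n.+1 by rewrite /r rising_factS mul1r.
  by rewrite [_ * x * _]mulrAC mulrC mulKf // mulf_neq0 ?gt_eqF.
have pV : \sum_k p k * (t k - x) ^+ 2 <= B.
  apply: le_trans (polya_variance_le _ _ _ hx).
  rewrite -/c -[leRHS](mulfK (lt0r_neq0 r0)) -sum_polya_weight_var ?gt_eqF //.
  by rewrite mulr_suml; apply: ler_sum => k _; rewrite mulrC mulrA.
by rewrite opE; exact: C1_01_mean_dist_le.
Qed.

Theorem theorem5p4 (R : realType) (f : R -> R) (hf : C1_01 f)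
    (n : nat) (hn : (1 < n)%N) (x : R) (hx : 0 <= x <= 1) :
  `|polya_op n f x - f x| <=
     omega1 f (n%:R `^ (- 2^-1)) / n%:R `^ 2^-1 *
     (x * (1 - x) * (1 - Num.min x (1 - x)) +
      Num.sqrt (x * (1 - x) * (1 - Num.min x (1 - x))))
  /\
  `|polya_op n f x - f x| <=
     (4 + 6 * Num.sqrt 3) / 27 * n%:R `^ (- 2^-1) *
     omega1 f (n%:R `^ (- 2^-1)).
Proof.
have n0 : 0 < n%:R :> R by rewrite ltr0n ltnW.
rewrite powRN powR12_sqrt ?(ltW n0) //.
set s := Num.sqrt n%:R; set m := Num.min x (1 - x).
pose A := x * (1 - x) * (1 - m); rewrite -/A.
have s0 : 0 < s by rewrite sqrtr_gt0.
have ss : s ^+ 2 = n%:R by rewrite sqr_sqrtr ?ltW.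
have [m0 mx mx'] := min_onem_bounds _ _ hx; rewrite -/m in m0 mx mx'.
have /andP[x0 x1] := hx.
have first_bound :
    `|polya_op n f x - f x| <= omega1 f s^-1 / s * (A + Num.sqrt A).
  apply: le_trans (polya_op_dist_le _ _ _ _ _ hf hn hx (_ : 0 < s^-1)) _.
    by rewrite invr_gt0.
  (* With [d = 1 / s] and [s^2 = n], both [sqrt (A / n)] and [(A / n) / d] acquire the factor
     [1 / s]. *)
  rewrite -/m -/A -ss sqrtrM; last by rewrite !mulr_ge0 ?subr_ge0 //; lra.
  rewrite sqrtrV ?sqr_ge0 // sqrtr_sqr gtr0_norm //.
  by rewrite le_eqVlt; apply/orP; left; apply/eqP; field; rewrite gt_eqF.
split => //; apply: (le_trans first_bound).
(* In either case of the minimum, [x (1 - x) = m (1 - m)]. *)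
have AE : A = m * (1 - m) ^+ 2.
  by rewrite /A /m; case: (leP x (1 - x)) => _; ring.
have A427 : A <= 4 / 27.
  (* This product equals [4 - 27 m (1 - m)^2]; the double root is the maximiser [m = 1/3]. *)
  have : 0 <= (1 - 3 * m) ^+ 2 * (4 - 3 * m).
    by rewrite mulr_ge0 ?sqr_ge0 //; lra.
  by rewrite AE => h; lra.
have sA : Num.sqrt A <= 6 * Num.sqrt 3 / 27.
  have -> : 6 * Num.sqrt 3 / 27 = Num.sqrt (4 / 27) :> R.
    rewrite -[LHS]ger0_norm ?mulr_ge0 ?sqrtr_ge0 // -sqrtr_sqr.
    by congr Num.sqrt; rewrite !exprMn sqr_sqrtr //; field.
  by rewrite ler_wsqrtr.
have w0 : 0 <= omega1 f s^-1 by rewrite omega1_ge0 // invr_ge0 ltW.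
have -> : (4 + 6 * Num.sqrt 3) / 27 / s * omega1 f s^-1 =
    omega1 f s^-1 / s * (4 / 27 + 6 * Num.sqrt 3 / 27) by ring.
by rewrite ler_wpM2l ?lerD // divr_ge0 // ltW.
Qed.
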